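(* Let $q\ge2$, $d\ge1$, and let $(\kappa_l)$, $l\in\mathbb N^{q-1}$, $0<|l|\le d$, be complex numbers. The expansion $$\mathbb P(n\mid m)=\mathfrak p(n)\Big\{1+\sum_{l:\,0<|l|\le d}\kappa_l\,h_l\,Q_l(m;(\theta_k))\,\overline{Q_l(n;(\theta_k))}\Big\},\qquad m,n\in\mathcal P_{d,q},$$ is a transition function on $\mathcal P_{d,q}$ if and only if there is a random variable $U$ on $\mathcal P_{d,q}$ such that $$\kappa_l=h_l\,\mathbb E\big[Q_l(U;(\theta_k))\big]\qquad\text{for all } l \text{ with } 0<|l|\le d.$$ Then the expansion can be written as $$\mathfrak p(n)\,\mathbb E\Big[1+\sum_{l:\,0<|l|\le d}h_l^2\,Q_l(U;(\theta_k))\,Q_l(m;(\theta_k))\,\overline{Q_l(n;(\theta_k))}\Big],$$ with expectation over $U$.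
   Context: $\theta_l=e^{2\pi i l/q}$, $\mathbb N=\{0,1,2,\ldots\}$. $\mathcal P_{d,q}$ is the set of vectors $m=(m[0],\ldots,m[q-1])$ of non-negative integers with sum $d$, and $\mathfrak p(m)=\frac{d!}{m[0]!\cdots m[q-1]!}q^{-d}$. For $l=(l_1,\ldots,l_{q-1})$, $|l|=l_1+\cdots+l_{q-1}$ and $h_l^{-1}=\frac{d!}{(d-|l|)!\,l_1!\cdots l_{q-1}!}$. The multivariate Krawtchouk polynomial $Q_l(m;(\theta_k))$ is the coefficient of $w_1^{l_1}\cdots w_{q-1}^{l_{q-1}}$ in $\prod_{j=0}^{q-1}\big(1+\sum_{k=1}^{q-1}w_k\theta_k^j\big)^{m[j]}$. A transition function is a function $\mathbb P(n\mid m)\ge0$ with $\sum_n\mathbb P(n\mid m)=1$ for every $m$. *)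

(* Defs.v *)
From HB Require Import structures.
From mathcomp Require Import all_boot all_order all_algebra.
(* The notations of mpoly conflict with those of MathComp-Analysis. *)
From mathcomp Require Export -(notations) mpoly.
From mathcomp Require Export complex.
From mathcomp Require Export all_classical all_reals all_analysis.

Set Implicit Arguments.
Unset Strict Implicit.
Unset Printing Implicit Defensive.
Import Order.TTheory GRing.Theory Num.Theory.
Local Open Scope ring_scope.

(* P_{d,q}; the entries are at most d because they sum to d. *)
Record composition (d q : nat) := Composition {
  parts :> {ffun 'I_q -> 'I_d.+1};
  _ : (\sum_(j < q) parts j)%N == d }.

HB.instance Definition _ d q := [isSub for @parts d q].
HB.instance Definition _ d q := [Finite of composition d q by <:].

Lemma concentrated_subproof d p :
  (\sum_(j < p.+1)
     [ffun j : 'I_p.+1 => if j == ord0 then ord_max else ord0 : 'I_d.+1] j)%N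
  == d.
Proof.
rewrite big_ord_recl ffunE eqxx /= big1 ?addn0 // => j _.
by rewrite ffunE eq_sym (negbTE (neq_lift _ _)).
Qed.

(* Measurable spaces are inhabited in MathComp-Analysis, and P_{d,0} is empty
   when 0 < d; hence the restriction to a positive number of parts. *)
HB.instance Definition _ d p :=
  isPointed.Build (composition d p.+1) (Composition (concentrated_subproof d p)).
HB.instance Definition _ d p :=
  @isMeasurable.Build default_measure_display (composition d p.+1)
    discrete_measurable discrete_measurable0
    discrete_measurableC discrete_measurableU.

(* Throughout, p = q - 1 is the number of variables w_1, ..., w_p; the
   ordinal k : 'I_p stands for the index k + 1, both for the variables and for
   the components of the multi-indices l : multinom p (for which |l| is
   mdeg l). *)
Section Krawtchouk.
Variable R : realType.
Implicit Types (d p q : nat).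

(* theta q l is exp(2 i pi l / q). *)
Definition theta q (l : nat) : R[i] :=
  (cos (2 * pi * l%:R / q%:R) +i* sin (2 * pi * l%:R / q%:R))%C.

Definition multinomial_pmf d q (m : composition d q) : R[i] :=
  d`!%:R / (\prod_(j < q) (m j)`!)%:R * q%:R ^- d.

(* This is h_l, not its inverse; it is meaningful for |l| <= d only. *)
Definition hcoef d p (l : multinom p) : R[i] :=
  (d`!%:R / ((d - mdeg l)`! * \prod_(k < p) (l k)`!)%:R)^-1.

Definition krawtchouk d p (t : nat -> R[i]) (l : multinom p)
    (m : composition d p.+1) : R[i] :=
  mcoeff l
    (\prod_(j < p.+1)
       (1 + \sum_(k < p) (t k.+1 ^+ j) *: mpolyX R[i] (mnm1 k)) ^+ m j).

Local Notation Q p l m := (krawtchouk (theta p.+1) l m).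

(* krawtchouk_expansion kappa n m is P(n | m); the values of kappa at l with
   l = 0 or |l| > d are irrelevant. *)
Definition krawtchouk_expansion d p (kappa : multinom p -> R[i])
    (n m : composition d p.+1) : R[i] :=
  multinomial_pmf n *
    (1 + \sum_(l : bmultinom p d.+1 | (0 < mdeg l)%N)
           kappa l * hcoef d l * Q p l m * (Q p l n)^*%C).

(* trans n m is P(n | m); 0 <= z in R[i] means that z is real and
   nonnegative. *)
Definition transition_function (S : finType) (trans : S -> S -> R[i]) : Prop :=
  (forall n m, 0 <= trans n m) /\ (forall m, \sum_n trans n m = 1).

Definition complex_expectation disp (T : measurableType disp)
    (P : probability T R) (X : T -> R[i]) : R[i] :=
  (fine 'E_P[fun w => complex.Re (X w)] +i*
   fine 'E_P[fun w => complex.Im (X w)])%C.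

End Krawtchouk.

(* Main.v *)
From HB Require Import structures.
Require Import Defs.
From mathcomp Require Import all_boot all_order all_algebra.
From mathcomp Require Import ring lra.
Import Order.TTheory GRing.Theory Num.Theory.
Local Open Scope ring_scope.

Set Implicit Arguments.
Unset Strict Implicit.
Unset Printing Implicit Defensive.

(* Lift everything to words x in (Z/q)^d, with the characters
   chi_a(x) = prod_i theta_(a_i x_i).  If x has type m (m[j] letters equal
   to j), then Q_l(m) is the sum of chi_a(x) over the words a with multi-index
   l, and h_l^-1 is the number of these words; hence the orthogonality of the
   Q_l under the multinomial law.  By the symmetry chi_a(x) = chi_x(a),
   h_l Q_l(m) is also the average of chi_a over the words of type m, for any
   fixed a with multi-index l.  Therefore
   sum_l h_l^2 Q_l(u) Q_l(m) conj(Q_l(n)) is an average of the sums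
   sum_a chi_a(z) chi_a(y) conj(chi_a(x)) = q^d 1[z + y = x] >= 0, which gives
   nonnegativity for kappa_l = h_l E Q_l(U).  Conversely, take U distributed
   as P(. | m) with m concentrated at 0, where Q_l(m) = h_l^-1. *)

(** * Counting words of a given type *)

Lemma sum_count_mem (T : finType) (s : seq T) :
  (\sum_(j : T) count_mem j s)%N = size s.
Proof.
elim: s => [|x s IHs] /=; first by rewrite big1.
rewrite big_split /= IHs (bigD1 x) //= eqxx big1 // => j /negPf.
by rewrite eq_sym => ->.
Qed.

(** Induction on the length, classifying permutations by their first letter [x]: putting [x] back
    into [rem x s] multiplies the product of factorials by the multiplicity of [x], and the
    multiplicities add up to the length. *)
Lemma size_permutations_fact (T : finType) (s : seq T) :
  (size (permutations s) * \prod_(j : T) (count_mem j s)`!)%N = (size s)`!.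
Proof.
have [n] := ubnP (size s); elim: n s => // n IHn s; rewrite ltnS => le_s_n.
have [s0|s_gt0] := posnP (size s).
  by rewrite (size0nil s0) big1.
rewrite (perm_size (permutationsE s_gt0)) size_allpairs_dep sumnE big_map.
have remE x : x \in s ->
    (size (permutations (rem x s)) * \prod_(j : T) (count_mem j s)`!)%N
    = (count_mem x s * (size s).-1`!)%N.
  move=> xs; rewrite -(size_rem xs) -IHn; last first.
    by rewrite size_rem //; case: (size s) s_gt0 le_s_n.
  rewrite mulnCA; congr (_ * _)%N.
  rewrite (bigD1 x) // [in RHS](bigD1 x) //= mulnA.
  have cE j : count_mem j s = ((x == j) + count_mem j (rem x s))%N.
    by have /permP/(_ (pred1 j)) := perm_to_rem xs.
  congr (_ * _)%N; first by rewrite cE eqxx add1n factS.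
  by apply: eq_bigr => j /negPf; rewrite cE eq_sym => ->.
rewrite big_distrl /= big_seq.
under eq_bigr => x do [rewrite mem_undup => xs; rewrite (remE x xs)].
rewrite -big_seq -big_distrl /= big_uniq ?undup_uniq //=.
transitivity (size s * (size s).-1`!)%N; last by case: (size s) s_gt0.
congr (_ * _)%N; rewrite -sum_count_mem [RHS](bigID (mem s)) /=.
rewrite [X in (_ + X)%N]big1 ?addn0.
  by apply: eq_bigl => x; rewrite mem_undup.
by move=> j js; apply/eqP; rewrite -leqn0 leqNgt -has_count has_pred1.
Qed.

Lemma count_codom (d q : nat) (x : {ffun 'I_d -> 'I_q}) (j : 'I_q) :
  count_mem j (codom x) = (\sum_(i < d) (x i == j))%N.
Proof. by rewrite count_map -sum1_count big_enum_cond [LHS]big_mkcond. Qed.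

Lemma occurrences_bound (d q : nat) (x : {ffun 'I_d -> 'I_q}) (j : 'I_q) :
  (\sum_(i < d) (x i == j) < d.+1)%N.
Proof.
by rewrite ltnS -[X in (_ <= X)%N]card_ord -sum1_card leq_sum // => i _; case: eqP.
Qed.

Lemma occurrences_subproof (d q : nat) (x : {ffun 'I_d -> 'I_q}) :
  (\sum_(j < q) [ffun j => Ordinal (occurrences_bound x j)] j)%N == d.
Proof.
under eq_bigr => j _ do rewrite ffunE /= -count_codom.
by rewrite sum_count_mem size_codom card_ord.
Qed.

(** The type of the word [x], in the sense of the overview. *)
Definition occurrences (d q : nat) (x : {ffun 'I_d -> 'I_q}) :=
  Composition (occurrences_subproof x).

Lemma occurrencesE d q (x : {ffun 'I_d -> 'I_q}) (j : 'I_q) :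
  occurrences x j = (\sum_(i < d) (x i == j))%N :> nat.
Proof. by rewrite ffunE. Qed.

Lemma composition_eqP d q (m n : composition d q) :
  (forall j, m j = n j :> nat) -> m = n.
Proof. by move=> mn; apply/val_inj/ffunP => j; apply/val_inj/mn. Qed.

Lemma occurrences_surj d q (m : composition d q) :
  exists x : {ffun 'I_d -> 'I_q}, occurrences x = m.
Proof.
(* The witness lists [m j] copies of each letter [j], block after block. *)
pose s := flatten [seq nseq (m j) j | j <- enum 'I_q].
have cs j : count_mem j s = m j.
  rewrite count_flatten -map_comp sumnE big_map big_enum /= (bigD1 j) //=.
  rewrite count_nseq /= eqxx mul1n big1 ?addn0 // => k /negPf kj.
  by rewrite count_nseq /= kj.
have ss : size s == d.
  rewrite -sum_count_mem; case: (m) cs => f /= fE cs; rewrite -(eqP fE).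
  by apply/eqP/eq_bigr => j _; rewrite cs.
have [t ts] : exists t : d.-tuple 'I_q, s = t by exists (Tuple ss).
exists [ffun i => tnth t i]; apply: composition_eqP => j.
rewrite occurrencesE -cs ts -[in RHS](map_tnth_enum t).
rewrite count_map -sum1_count big_enum_cond [RHS]big_mkcond /=.
by apply: eq_bigr => i _; rewrite ffunE.
Qed.

(** The words of type [m] are exactly the rearrangements of one of them, so their number is a
    multinomial coefficient. *)
Lemma card_occurrences d q (m : composition d q) :
  (#|[pred x : {ffun 'I_d -> 'I_q} | occurrences x == m]|
   * \prod_(j < q) (m j)`!)%N = d`!.
Proof.
have [x0 x0m] := occurrences_surj m.
transitivity (size (codom x0))`!; last by rewrite size_codom card_ord.
rewrite -size_permutations_fact; congr (_ * _)%N; last first.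
  by apply: eq_bigr => j _; rewrite count_codom -occurrencesE x0m.
rewrite cardE -(size_map (fun x : {ffun 'I_d -> 'I_q} => codom x)).
apply/perm_size/uniq_perm; rewrite ?permutations_uniq //.
  rewrite map_inj_uniq ?enum_uniq // => x y; rewrite !codomE => /eq_in_map xy.
  by apply/ffunP => i; apply: xy; rewrite mem_enum.
have occ_eq x : (occurrences x == m) = perm_eq (codom x) (codom x0).
  apply/eqP/allP => [xm j _ | xx0] /=.
    by rewrite !count_codom -!occurrencesE xm x0m.
  rewrite -x0m; apply: composition_eqP => j; rewrite !occurrencesE -!count_codom.
  have /permP -> // : perm_eq (codom x) (codom x0) by apply/allP.
move=> t; rewrite mem_permutations; apply/mapP/idP => [[x xm ->]|tx0].
  by rewrite -occ_eq; move: xm; rewrite mem_enum.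
have st : size t == d by rewrite (perm_size tx0) size_codom card_ord.
have tE : t = codom [ffun i => tnth (Tuple st) i].
  rewrite codomE -[LHS]/(val (Tuple st)) -[LHS]map_tnth_enum.
  by apply: eq_map => i; rewrite ffunE.
by exists [ffun i => tnth (Tuple st) i] => //; rewrite mem_enum inE occ_eq -tE.
Qed.

(** * Roots of unity and their geometric sums *)

Section Theta.
Variables (R : realType) (q : nat).
Hypothesis q_gt0 : (0 < q)%N.
Local Notation theta := (theta R q).

Lemma theta0 : theta 0 = 1.
Proof. by rewrite /Defs.theta mulr0 mul0r cos0 sin0. Qed.

Lemma thetaD k l : theta (k + l) = theta k * theta l.
Proof.
rewrite /Defs.theta natrD mulrDr mulrDl cosD sinD; simpc.
by rewrite [X in (_ +i* X)%C]addrC.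
Qed.

Lemma thetaM k n : theta (k * n) = theta k ^+ n.
Proof.
elim: n => [|n IHn]; first by rewrite muln0 theta0.
by rewrite mulnS thetaD IHn exprS.
Qed.

Lemma thetaq : theta q = 1.
Proof.
rewrite /Defs.theta mulfK ?pnatr_eq0 -?lt0n // mulr_natl cos2pi.
by rewrite sin_mulr2n sinpi mulr0 mul0rn.
Qed.

Lemma conj_theta k : ((theta k)^*)%C * theta k = 1.
Proof.
rewrite /Defs.theta /=; simpc; apply/eqP; rewrite eq_complex /=.
by rewrite -!expr2 cos2Dsin2 [cos _ * _]mulrC subrr !eqxx.
Qed.

(** Indices are natural numbers, so [q - x] stands for the inverse of [x] modulo [q]. *)
Lemma conj_theta_compl k x : (x <= q)%N ->
  ((theta (k * x))^*)%C = theta (k * (q - x)).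
Proof.
move=> x_le_q; rewrite -[LHS]mulr1.
have <- : theta (k * x) * theta (k * (q - x)) = 1.
  by rewrite -thetaD -mulnDr subnKC // mulnC thetaM thetaq expr1n.
by rewrite mulrA conj_theta mul1r.
Qed.

Lemma theta_eq1 k : (theta k == 1) = (q %| k)%N.
Proof.
rewrite {1}(divn_eq k q) thetaD mulnC thetaM thetaq expr1n mul1r /dvdn.
have := ltn_pmod k q_gt0; move: (k %% q)%N => r r_lt_q.
case: posnP => [->|r_gt0]; first by rewrite theta0 eqxx.
apply/negP; rewrite eq_complex /= => /andP[/eqP cos1 _].
(* Half the angle of [theta r]: it lies strictly between 0 and pi, where the sine is positive,
   whereas [cos (2 x) = 1] forces [sin x = 0]. *)
pose x : R := trigo.pi * r%:R / q%:R.
have q0 : (0 : R) < q%:R by rewrite ltr0n.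
have : 0 < sin x.
  apply: sin_gt0_pi; rewrite /x -mulrA pmulr_rgt0 ?pi_gt0 // divr_gt0 ?ltr0n //=.
  by rewrite gtr_pMr ?pi_gt0 // ltr_pdivrMr // mul1r ltr_nat.
suff -> : sin x = 0 by rewrite ltxx.
have : cos (x *+ 2) = 1.
  by rewrite -[RHS]cos1 -[x *+ 2]mulr_natl /x !mulrA.
rewrite cos_mulr2n cos2sin2 => sin1.
have /eqP : sin x ^+ 2 = 0 by lra.
by rewrite expf_eq0 /= => /eqP.
Qed.

Lemma sum_theta k :
  \sum_(b < q) theta (b * k) = if (q %| k)%N then q%:R else 0.
Proof.
under eq_bigr => b _ do rewrite mulnC thetaM.
rewrite -theta_eq1; case: eqP => [->|/eqP k1].
  by under eq_bigr do rewrite expr1n; rewrite sumr_const card_ord.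
(* Geometric sum: its product with [theta k - 1] is [theta k ^+ q - 1 = 0], and [theta k - 1] is
   nonzero. *)
apply/eqP; have /eqP := subrX1 (theta k) q.
by rewrite -thetaM mulnC thetaM thetaq expr1n subrr eq_sym mulf_eq0 subr_eq0 (negPf k1).
Qed.

End Theta.

(** * Characters of words, and Krawtchouk polynomials as sums of characters *)

Section Characters.
Variables (R : realType) (d p : nat).
Local Notation q := p.+1.
Local Notation C := R[i].
Local Notation theta := (theta R q).
Local Notation word := {ffun 'I_d -> 'I_q}.
Local Notation Q := (@krawtchouk R d p theta).
Implicit Types (a b x y z : word) (l : multinom p) (m n u : composition d q).

Definition character a x : C := \prod_(i < d) theta (a i * x i).

Lemma characterC a x : character a x = character x a.
Proof. by apply: eq_bigr => i _; rewrite mulnC. Qed.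

Lemma conj_character a x :
  ((character a x)^*)%C = \prod_(i < d) theta (a i * (q - x i)).
Proof.
rewrite rmorph_prod; apply: eq_bigr => i _.
by apply: conj_theta_compl => //; apply/ltnW.
Qed.

(** The sum over words factors into one geometric sum per position. *)
Lemma sum_prod_theta (k : 'I_d -> nat) :
  \sum_(a : word) \prod_(i < d) theta (a i * k i) =
  \prod_(i < d) (if (q %| k i)%N then q%:R else 0).
Proof.
rewrite -(bigA_distr_bigA (fun i (b : 'I_q) => theta (b * k i))).
by apply: eq_bigr => i _; rewrite sum_theta.
Qed.

(** Position [i] contributes [q] if [q] divides [x i + (q - y i)] and 0 otherwise; for letters below
    [q] this divisibility means [x i = y i]. *)
Lemma character_orthogonal x y :
  \sum_a character a x * ((character a y)^*)%C = (x == y)%:R * q%:R ^+ d.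
Proof.
under eq_bigr => a _.
  rewrite conj_character -big_split /=.
  under eq_bigr => i _ do rewrite -thetaD -mulnDr.
  over.
rewrite sum_prod_theta; case: eqP => [->|/eqP xy].
  under eq_bigr => i _ do rewrite subnKC ?dvdnn 1?ltnW //.
  by rewrite prodr_const card_ord mul1r.
have [i xyi] : exists i, x i != y i.
  by apply/existsP; apply: contraNT xy => /existsPn xy; apply/eqP/ffunP => i;
    apply/eqP/negPn.
rewrite mul0r (bigD1 i) //= ifN ?mul0r //; apply: contra xyi => qxy.
apply/eqP/val_inj; rewrite /= -(modn_small (ltn_ord (x i))).
rewrite -[RHS](modn_small (ltn_ord (y i))).
apply/eqP; rewrite -(eqn_modDr (q - y i)) subnKC; last by apply/ltnW.
by rewrite modnn.
Qed.

(** The sum factors over the positions, and every factor is [q] or 0. *)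
Lemma character_triple_ge0 x y z :
  0 <= \sum_a character a x * character a y * ((character a z)^*)%C.
Proof.
under eq_bigr => a _.
  rewrite conj_character -!big_split /=.
  under eq_bigr => i _ do rewrite -!thetaD -!mulnDr.
  over.
by rewrite sum_prod_theta prodr_ge0 // => i _; case: ifP.
Qed.

(* Position [j] of a word contributes the variable [w_j], and nothing when
   [j = 0]; in ['I_p] the index [j] is [k] with [j = lift ord0 k]. *)
Definition letter (j : 'I_q) : multinom p :=
  if unlift ord0 j is Some k then mnm1 k else mnm0.

Definition multi_index a : multinom p := \big[mnm_add/mnm0]_(i < d) letter (a i).

Lemma multi_indexE a k : multi_index a k = occurrences a (lift ord0 k) :> nat.
Proof.
rewrite mnm_sumE occurrencesE; apply: eq_bigr => i _.
rewrite /letter; case: unliftP => [j ->|->]; last by rewrite mnm0E.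
by rewrite mnm1E (inj_eq (@lift_inj _ ord0)).
Qed.

Lemma composition_recl m : (m ord0 + \sum_(k < p) m (lift ord0 k) = d)%N.
Proof. by case: m => f /= /eqP; rewrite big_ord_recl. Qed.

Lemma mdeg_multi_index a : (occurrences a ord0 + mdeg (multi_index a) = d)%N.
Proof.
rewrite -[RHS](composition_recl (occurrences a)) mdegE; congr (_ + _)%N.
by apply: eq_bigr => k _; rewrite multi_indexE.
Qed.

Lemma mdeg_multi_index_bound a : (mdeg (multi_index a) < d.+1)%N.
Proof. by rewrite ltnS -(mdeg_multi_index a) leq_addl. Qed.

(** A multi-index omits only the number of letters 0, which is recovered as [d] minus its degree. *)
Lemma multi_index_eq a b :
  (multi_index a == multi_index b) = (occurrences a == occurrences b).
Proof.
apply/eqP/eqP => [ab|ab]; last first.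
  by apply/mnmP => k; rewrite !multi_indexE ab.
apply: composition_eqP => j; case: (unliftP ord0 j) => [k ->|->].
  by rewrite -!multi_indexE ab.
apply: (@addIn (mdeg (multi_index b))).
by rewrite mdeg_multi_index -ab mdeg_multi_index.
Qed.

Lemma multi_index_surj l : (mdeg l <= d)%N -> exists a, multi_index a = l.
Proof.
move=> l_le_d.
have lk k : (l k <= mdeg l)%N by rewrite mdegE (bigD1 k) //= leq_addr.
(* The missing [d - mdeg l] letters are set to 0. Each [inord] keeps its value, as
   [l k <= mdeg l <= d]. *)
pose f : {ffun 'I_q -> 'I_d.+1} := [ffun j => if unlift ord0 j is Some k then inord (l k)
                            else inord (d - mdeg l)].
have f0 : f ord0 = (d - mdeg l)%N :> nat.
  by rewrite ffunE unlift_none inordK // ltnS leq_subr.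
have fk k : f (lift ord0 k) = l k :> nat.
  by rewrite ffunE liftK inordK // ltnS (leq_trans (lk k)).
have sumf : (\sum_(j < q) f j)%N == d.
  rewrite big_ord_recl f0; under eq_bigr do rewrite fk.
  by rewrite -mdegE subnK.
have [a a_f] := occurrences_surj (Composition sumf).
by exists a; apply/mnmP => k; rewrite multi_indexE a_f fk.
Qed.

Lemma hcoef_multi_index a :
  hcoef R d (multi_index a) =
  #|[pred b | multi_index b == multi_index a]|%:R^-1.
Proof.
rewrite /hcoef; congr (_^-1).
rewrite (eq_card (B := [pred b | occurrences b == occurrences a])); last first.
  by move=> b; rewrite !inE multi_index_eq.
rewrite -(card_occurrences (occurrences a)) natrM.
have <- : (\prod_(j < q) (occurrences a j)`!)%N =
    ((d - mdeg (multi_index a))`! * \prod_(k < p) (multi_index a k)`!)%N.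
  rewrite big_ord_recl; congr (_`! * _)%N.
    by apply/eqP; rewrite -(eqn_add2r (mdeg (multi_index a))) subnK
      ?mdeg_multi_index // -ltnS mdeg_multi_index_bound.
  by apply: eq_bigr => k _; rewrite multi_indexE.
rewrite mulfK // pnatr_eq0 -lt0n prodn_gt0 // => j.
exact: fact_gt0.
Qed.

Lemma multinomial_pmfE m :
  multinomial_pmf R m = #|[pred x | occurrences x == m]|%:R * q%:R ^- d.
Proof.
rewrite /multinomial_pmf -(card_occurrences m) natrM mulfK //.
by rewrite pnatr_eq0 -lt0n prodn_gt0 // => j; apply: fact_gt0.
Qed.

Lemma multinomial_pmf_ge0 m : 0 <= multinomial_pmf R m.
Proof. by rewrite multinomial_pmfE mulr_ge0 ?invr_ge0 ?exprn_ge0. Qed.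

(** The multinomial law is the law of the type of a uniformly random word. *)
Lemma sum_multinomial_pmf (f : composition d q -> C) :
  \sum_m multinomial_pmf R m * f m = q%:R ^- d * \sum_x f (occurrences x).
Proof.
rewrite (partition_big (@occurrences d q) predT) //= mulr_sumr.
apply: eq_bigr => m _.
have -> : \sum_(x | occurrences x == m) f (occurrences x)
          = f m *+ #|[pred x | occurrences x == m]|.
  by rewrite -sumr_const; apply: eq_bigr => x /eqP ->.
by rewrite multinomial_pmfE -[f m *+ _]mulr_natl [RHS]mulrCA mulrA.
Qed.

(** Regrouped by positions, the generating function is a product over [i] of sums over letters [b]
    of [theta (b * x i)] times the variable of [b], which is 1 for [b = 0]. Expanding it gives one
    monomial per word. *)
Lemma krawtchouk_occurrences l x :
  Q l (occurrences x) = \sum_(a | multi_index a == l) character a x.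
Proof.
rewrite /krawtchouk.
set F := fun j : 'I_q => 1 + \sum_(k < p) (theta k.+1 ^+ j) *: mpolyX R[i] (mnm1 k).
have -> : \prod_(j < q) F j ^+ occurrences x j = \prod_(i < d) F (x i).
  under eq_bigr => j _ do rewrite occurrencesE -prodrXr.
  rewrite exchange_big; apply: eq_bigr => i _ /=.
  rewrite (bigD1 (x i)) //= eqxx expr1 big1 ?mulr1 // => j /negPf.
  by rewrite eq_sym => ->.
have FE j : F j = \sum_(b < q) theta (b * j) *: mpolyX R[i] (letter b).
  rewrite big_ord_recl mul0n theta0 scale1r /letter unlift_none mpolyX0.
  congr (_ + _); apply: eq_bigr => k _.
  by rewrite liftK -thetaM.
under eq_bigr => i _ do rewrite FE.
rewrite bigA_distr_bigA raddf_sum [RHS]big_mkcond /=; apply: eq_bigr => a _.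
rewrite scaler_prod mprodXE mcoeffZ mcoeffX.
by case: eqP => _; rewrite ?mulr1 ?mulr0.
Qed.

Lemma krawtchouk0 m : Q mnm0 m = 1.
Proof.
rewrite /krawtchouk rmorph_prod big1 // => j _.
rewrite rmorphXn rmorphD rmorph1 raddf_sum big1 ?addr0 ?expr1n // => k _.
by rewrite /= mcoeffZ mcoeffX mnm1_eq0 mulr0.
Qed.

(** Every word has a multi-index of degree at most [d], so the fibres of [multi_index] over these
    [l] partition all words. *)
Lemma sum_krawtchouk_conj (f : multinom p -> C) x :
  \sum_(l : bmultinom p d.+1) f l * ((Q l (occurrences x))^*)%C =
  \sum_a f (multi_index a) * ((character a x)^*)%C.
Proof.
rewrite [RHS](partition_big (fun a => BMultinom (mdeg_multi_index_bound a)) predT) //=.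
apply: eq_bigr => l _; rewrite krawtchouk_occurrences rmorph_sum mulr_sumr.
by apply: eq_big => [a|a /eqP <-].
Qed.

(* Double counting of the sum of [character b z] over the [b] with the
   multi-index of [a] and the [z] of type [u]: by the symmetry of the
   character each inner sum is constant in the outer variable. *)
Lemma krawtchouk_dual a u :
  hcoef R d (multi_index a) * Q (multi_index a) u =
  #|[pred z | occurrences z == u]|%:R^-1 *
    \sum_(z | occurrences z == u) character a z.
Proof.
have [x x_u] := occurrences_surj u.
pose S : C := \sum_(b | multi_index b == multi_index a)
                \sum_(z | occurrences z == u) character b z.
have SE : S = #|[pred b | multi_index b == multi_index a]|%:R
              * \sum_(z | occurrences z == u) character a z.
  rewrite mulr_natl -sumr_const; apply: eq_bigr => b; rewrite multi_index_eq => /eqP ba.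
  (* With the roles of words and types exchanged, the inner sum is itself a Krawtchouk value, hence
     depends only on the type of [c]. *)
  have E c : \sum_(z | occurrences z == u) character c z =
      Q (multi_index x) (occurrences c).
    rewrite krawtchouk_occurrences -x_u.
    by apply: eq_big => [z|z _]; rewrite ?multi_index_eq // characterC.
  by rewrite !E ba.
have SE' : S = #|[pred z | occurrences z == u]|%:R * Q (multi_index a) u.
  rewrite /S exchange_big mulr_natl -sumr_const; apply: eq_bigr => z /eqP <-.
  by rewrite krawtchouk_occurrences.
have A0 : #|[pred b | multi_index b == multi_index a]|%:R != 0 :> C.
  by rewrite pnatr_eq0 -lt0n; apply/card_gt0P; exists a; rewrite inE.
have Z0 : #|[pred z | occurrences z == u]|%:R != 0 :> C.
  by rewrite pnatr_eq0 -lt0n; apply/card_gt0P; exists x; rewrite inE x_u.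
rewrite hcoef_multi_index; apply: (mulfI A0); rewrite mulVKf // mulrCA -SE SE'.
by rewrite mulKf.
Qed.

Lemma krawtchouk_triple_ge0 u m n :
  0 <= \sum_(l : bmultinom p d.+1)
         hcoef R d l ^+ 2 * Q l u * Q l m * ((Q l n)^*)%C.
Proof.
have [x <-] := occurrences_surj n.
rewrite (sum_krawtchouk_conj (fun l => hcoef R d l ^+ 2 * Q l u * Q l m)).
(* One factor [h_l] goes to [Q_l(u)] and one to [Q_l(m)], turning both into averages of the
   character of the same word [a]. *)
under eq_bigr => a _.
  have -> : hcoef R d (multi_index a) ^+ 2 * Q (multi_index a) u
            * Q (multi_index a) m =
     (hcoef R d (multi_index a) * Q (multi_index a) u) *
     (hcoef R d (multi_index a) * Q (multi_index a) m).
    by rewrite mulrACA -expr2 mulrA.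
  rewrite !krawtchouk_dual mulrACA big_distrlr /= -!mulrA mulr_suml.
  under eq_bigr => z _ do rewrite mulr_suml.
  over.
rewrite -2!mulr_sumr !mulr_ge0 ?invr_ge0 // exchange_big.
apply: sumr_ge0 => z _; rewrite exchange_big; apply: sumr_ge0 => y _.
exact: character_triple_ge0.
Qed.

Lemma krawtchouk_orthogonal l l' :
  \sum_m multinomial_pmf R m * (Q l m * ((Q l' m)^*)%C) =
  (l == l')%:R * #|[pred a | multi_index a == l]|%:R.
Proof.
rewrite sum_multinomial_pmf.
under eq_bigr => x _.
  rewrite !krawtchouk_occurrences rmorph_sum big_distrlr /=.
  over.
rewrite exchange_big /=.
under eq_bigr => a al.
  rewrite exchange_big /=.
  under eq_bigr => b bl'.
    (* Orthogonality sums over the first argument of the character, here the sum runs over the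
       second; symmetry exchanges them. *)
    under eq_bigr => x _ do rewrite characterC [character b x]characterC.
    rewrite character_orthogonal; over.
  rewrite -big_distrl; over.
rewrite -big_distrl mulrCA mulVf ?mulr1; last first.
  by rewrite expf_eq0 pnatr_eq0 andbF.
rewrite mulr_natr -sumr_const /=; apply: eq_bigr => a /eqP al.
case: eqP => [<-|ll']; last first.
  by apply: big1 => b /eqP bl'; case: eqP => // ab; case: ll'; rewrite -al -bl' ab.
rewrite (bigD1 a) ?al //= eqxx big1 ?addr0 // => b /andP[_].
by rewrite eq_sym => /negPf ->.
Qed.

Lemma krawtchouk_concentrated l :
  Q l (occurrences [ffun=> ord0]) = #|[pred a | multi_index a == l]|%:R.
Proof.
rewrite krawtchouk_occurrences -sumr_const; apply: eq_bigr => a _.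
by apply: big1 => i _; rewrite ffunE muln0 theta0.
Qed.

End Characters.

(** * Probability measures and expectations on the finite set of compositions *)

Section Law.
Variables (R : realType) (d p : nat).
Local Notation S := (composition d p.+1).

Lemma probability_of_pmf (g : S -> R) :
  (forall m, 0 <= g m) -> \sum_m g m = 1 ->
  exists P : probability S R, forall m, P [set m]%classic = (g m)%:E.
Proof.
move=> g_ge0 sum_g.
(* The measure is a weighted sum of Dirac masses indexed by naturals, hence this enumeration; the
   default [point] is never reached below the cardinality. *)
pose e k : S := nth point (enum {: S}) k.
pose mu := msum (fun k => mscale (NngNum (g_ge0 (e k))) (\d_(e k))%classic) #|{: S}|.
have muE A : mu A = (\sum_m g m * \1_A m)%:E.
  rewrite /mu /msum -sumEFin -[RHS]big_enum (big_nth point) -cardE big_mkord.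
  by apply: eq_bigr => k _; rewrite /mscale EFinM.
have mu1 : mu [set: S]%classic = 1%E.
  by rewrite muE -sum_g; congr (_%:E); apply: eq_bigr => m _; rewrite indicT mulr1.
pose P : probability S R := HB.pack mu (Measure_isProbability.Build _ _ _ mu mu1).
exists P => m; rewrite [LHS]muE (bigD1 m) //= big1 ?addr0.
  by rewrite indicE mem_set ?mulr1.
by move=> n /eqP nm; rewrite indicE memNset ?mulr0.
Qed.

Variables (disp : measure_display) (T : measurableType disp).
Variables (P : probability T R) (U : {RV P >-> S}).

Definition law (m : S) : R := fine (P (U @^-1` [set m])%classic).

Lemma measurable_fiber (m : S) : measurable (U @^-1` [set m])%classic.
Proof.
by rewrite -[X in measurable X]classical_sets.setTI; exact: measurable_funPT.
Qed.

Lemma law_ge0 m : 0 <= law m.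
Proof. by rewrite fine_ge0. Qed.

(** [f] composed with [U] is a finite linear combination of indicators of the fibres of [U]. *)
Lemma expectation_law (f : S -> R) :
  ('E_P[fun w => f (U w)] = (\sum_m law m * f m)%:E)%E.
Proof.
have fU w : f (U w) = \sum_m f m * \1_(U @^-1` [set m])%classic w.
  rewrite (bigD1 (U w)) //= indicE mem_set // mulr1 big1 ?addr0 // => m /eqP mU.
  by rewrite indicE memNset ?mulr0 // => /= Um; apply: mU.
rewrite expectation.unlock.
under eq_integral => w _ do rewrite fU -sumEFin.
rewrite integral_sum //; last first.
  move=> m; under [X in integrable _ _ X]funext do rewrite EFinM.
  by apply: integrableZl => //; apply: integrable_indic; exact: measurable_fiber.
rewrite -sumEFin; apply: eq_bigr => m _.
under eq_integral do rewrite EFinM.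
rewrite integralZl //; last by apply: integrable_indic; exact: measurable_fiber.
rewrite integral_indic ?classical_sets.setIT //; last exact: measurable_fiber.
by rewrite muleC EFinM fineK // fin_num_measure //; exact: measurable_fiber.
Qed.

Lemma complex_expectation_law (f : S -> R[i]) :
  complex_expectation P (fun w => f (U w)) = \sum_m (law m)%:C%C * f m.
Proof.
rewrite /complex_expectation (expectation_law (fun m => complex.Re (f m))).
rewrite (expectation_law (fun m => complex.Im (f m))) /=.
elim/big_rec3 : _ => // m y1 y2 y3 _; case: (f m) => a b <-.
by simpc.
Qed.

Lemma sum_law : \sum_m law m = 1.
Proof.
have := expectation_law (fun=> 1); rewrite expectation_cst => -[->].
by apply: eq_bigr => m _; rewrite mulr1.
Qed.

End Law.

(** * Positivity, moments and mixture form of the expansion *)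

Section Expansion.
Variables (R : realType) (d p : nat).
Local Notation q := p.+1.
Local Notation C := R[i].
Local Notation Q := (@krawtchouk R d p (theta R q)).
Implicit Types (l : multinom p) (m n u : composition d q).

Lemma hcoef0 : hcoef R d (mnm0 : multinom p) = 1.
Proof.
rewrite /hcoef; have -> : (\prod_(k < p) ((mnm0 : multinom p) k)`! = 1)%N.
  by apply: big1 => k _; rewrite mnm0E.
by rewrite mdeg0 subn0 muln1 divff ?invr1 // pnatr_eq0 -lt0n fact_gt0.
Qed.

Lemma sum_bmultinom_recl (F : multinom p -> C) :
  \sum_(l : bmultinom p d.+1) F l =
  F mnm0 + \sum_(l : bmultinom p d.+1 | (0 < mdeg l)%N) F l.
Proof.
have lt0 : (mdeg (mnm0 : multinom p) < d.+1)%N by rewrite mdeg0.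
rewrite (bigD1 (BMultinom lt0)) //=; congr (_ + _); apply: eq_bigl => l.
by rewrite lt0n mdeg_eq0.
Qed.

(** The leading 1 is the term [l = 0] of the full sum, since [h_0 = Q_0 = 1]. *)
Lemma krawtchouk_kernel_ge0 u m n :
  0 <= 1 + \sum_(l : bmultinom p d.+1 | (0 < mdeg l)%N)
             hcoef R d l ^+ 2 * Q l u * Q l m * ((Q l n)^*)%C.
Proof.
have := krawtchouk_triple_ge0 R u m n.
rewrite (sum_bmultinom_recl
  (fun l => hcoef R d l ^+ 2 * Q l u * Q l m * ((Q l n)^*)%C)).
by rewrite hcoef0 !krawtchouk0 rmorph1 !mulr1 expr1n.
Qed.

Lemma hcoef_card l : (mdeg l <= d)%N ->
  hcoef R d l * #|[pred a : {ffun 'I_d -> 'I_q} | multi_index a == l]|%:R = 1.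
Proof.
move=> /multi_index_surj[a <-]; rewrite hcoef_multi_index mulVf // pnatr_eq0 -lt0n.
by apply/card_gt0P; exists a; rewrite inE.
Qed.

Lemma krawtchouk_orthogonal_index l l' : (mdeg l <= d)%N ->
  \sum_m multinomial_pmf R m * (Q l m * ((Q l' m)^*)%C) =
  (l == l')%:R * (hcoef R d l)^-1.
Proof.
by move=> /hcoef_card hl; rewrite krawtchouk_orthogonal -(mulr1_eq hl).
Qed.

(** Orthogonality leaves only the coefficient with index [l], whose factor [h_l] cancels the squared
    norm [h_l^-1] of [Q_l]. *)
Lemma expansion_moment (kappa : multinom p -> C) m l : (mdeg l <= d)%N ->
  \sum_n krawtchouk_expansion kappa n m * Q l n =
  (if l == mnm0 then 1 else kappa l * Q l m).
Proof.
(* [F] extends the coefficients to [l' = 0], where the value 1 absorbs the constant term whatever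
   [kappa] is there. *)
move=> l_le_d; pose F l' := (if l' == mnm0 then 1 else kappa l' * hcoef R d l' * Q l' m).
have expansionE n : krawtchouk_expansion kappa n m * Q l n =
    \sum_(l' : bmultinom p d.+1)
       F l' * (multinomial_pmf R n * (Q l n * ((Q l' n)^*)%C)).
  rewrite /krawtchouk_expansion.
  have -> : 1 + \sum_(l' : bmultinom p d.+1 | (0 < mdeg l')%N)
      kappa l' * hcoef R d l' * Q l' m * ((Q l' n)^*)%C =
      \sum_(l' : bmultinom p d.+1) F l' * ((Q l' n)^*)%C.
    rewrite (sum_bmultinom_recl (fun l' => F l' * ((Q l' n)^*)%C)) /F eqxx.
    rewrite krawtchouk0 rmorph1 mulr1; congr (_ + _); apply: eq_bigr => l' l'0.
    by rewrite -mdeg_eq0 eqn0Ngt l'0.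
  rewrite mulr_sumr mulr_suml; apply: eq_bigr => l' _.
  by ring.
under eq_bigr => n _ do rewrite expansionE.
rewrite exchange_big /=.
under eq_bigr => l' _ do rewrite -mulr_sumr krawtchouk_orthogonal_index //.
have l_lt : (mdeg l < d.+1)%N by [].
rewrite (bigD1 (BMultinom l_lt)) //= eqxx mul1r big1 ?addr0 => [|l' ll'].
  rewrite /F; case: eqP => [->|_]; first by rewrite hcoef0 invr1 mulr1.
  have := hcoef_card l_le_d => hl.
  rewrite mulrAC mulfK //.
  by apply: contra_eq_neq hl => ->; rewrite mul0r eq_sym oner_neq0.
suff /negPf -> : l != l' by rewrite mul0r mulr0.
by apply: contra_neq ll' => ll'; exact: val_inj.
Qed.

(** The total mass is the moment at [l = 0], so only nonnegativity depends on [kappa]. *)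
Lemma sum_expansion (kappa : multinom p -> C) m :
  \sum_n krawtchouk_expansion kappa n m = 1.
Proof.
have := @expansion_moment kappa m mnm0; rewrite mdeg0 eqxx => <- //.
by apply: eq_bigr => n _; rewrite krawtchouk0 mulr1.
Qed.

Lemma expansion_expectation (kappa : multinom p -> C)
    (disp : measure_display) (T : measurableType disp)
    (P : probability T R) (U : {RV P >-> composition d q}) :
  (forall l, (0 < mdeg l <= d)%N ->
     kappa l = hcoef R d l * complex_expectation P (fun w => Q l (U w))) ->
  forall m n,
    krawtchouk_expansion kappa n m =
    multinomial_pmf R n *
      complex_expectation P (fun w =>
        1 + \sum_(l : bmultinom p d.+1 | (0 < mdeg l)%N)
              hcoef R d l ^+ 2 * Q l (U w) * Q l m * ((Q l n)^*)%C).
Proof.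
move=> kappaE m n; congr (_ * _).
rewrite (complex_expectation_law U (fun u => 1 +
  \sum_(l : bmultinom p d.+1 | (0 < mdeg l)%N)
     hcoef R d l ^+ 2 * Q l u * Q l m * ((Q l n)^*)%C)).
under [RHS]eq_bigr => u _ do rewrite mulrDr mulr1 mulr_sumr.
rewrite big_split /= -rmorph_sum sum_law rmorph1 exchange_big /=; congr (_ + _).
apply: eq_bigr => l l0; rewrite kappaE; last by rewrite l0 -ltnS bmdeg.
rewrite (complex_expectation_law U (Q l)) mulr_sumr !mulr_suml.
by apply: eq_bigr => u _; rewrite expr2; ring.
Qed.

End Expansion.

(* q = p + 1 *)
Theorem proposition13 (R : realType) (p d : nat) (hp : (0 < p)%N)
    (hd : (0 < d)%N) (kappa : multinom p -> R[i]) :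
  (transition_function (@krawtchouk_expansion R d p kappa) <->
   exists (disp : measure_display) (T : measurableType disp)
     (P : probability T R) (U : {RV P >-> composition d p.+1}),
     forall l : multinom p, (0 < mdeg l <= d)%N ->
       kappa l = hcoef R d l *
         complex_expectation P (fun w => krawtchouk (theta R p.+1) l (U w)))
  /\
  (forall (disp : measure_display) (T : measurableType disp)
     (P : probability T R) (U : {RV P >-> composition d p.+1}),
     (forall l : multinom p, (0 < mdeg l <= d)%N ->
       kappa l = hcoef R d l *
         complex_expectation P (fun w => krawtchouk (theta R p.+1) l (U w))) ->
     forall m n : composition d p.+1,
       krawtchouk_expansion kappa n m =
       multinomial_pmf R n *
         complex_expectation P (fun w =>
           1 + \sum_(l : bmultinom p d.+1 | (0 < mdeg l)%N)
                 hcoef R d l ^+ 2 * krawtchouk (theta R p.+1) l (U w)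
                 * krawtchouk (theta R p.+1) l m
                 * ((krawtchouk (theta R p.+1) l n)^*)%C)).
Proof.
split; last exact: expansion_expectation.
split=> [[trans_ge0 _]|[disp [T [P [U kappaE]]]]]; last first.
  split=> [n m|m]; last exact: sum_expansion.
  rewrite (expansion_expectation kappaE) mulr_ge0 ?multinomial_pmf_ge0 //.
  (* The expectation is a combination, with the point masses of [U] as weights, of kernels that are
     nonnegative for each value [u]. *)
  rewrite (complex_expectation_law U (fun u => 1 +
    \sum_(l : bmultinom p d.+1 | (0 < mdeg l)%N)
      hcoef R d l ^+ 2 * krawtchouk (theta R p.+1) l u
      * krawtchouk (theta R p.+1) l m * ((krawtchouk (theta R p.+1) l n)^*)%C)).
  apply: sumr_ge0 => u _; rewrite mulr_ge0 ?krawtchouk_kernel_ge0 //.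
  by rewrite lecR law_ge0.
(* [U] follows [P(. | d e_0)], as [Q_l] takes the value [h_l^-1] at [d e_0]. *)
pose m0 : composition d p.+1 := occurrences [ffun=> ord0].
(* Nonnegativity in [R[i]] includes being real, so taking the real part loses nothing. *)
pose g n := complex.Re (krawtchouk_expansion kappa n m0).
have gE n : (g n)%:C%C = krawtchouk_expansion kappa n m0.
  have := trans_ge0 n m0; rewrite lecE /g.
  by case: krawtchouk_expansion => a b /= /andP[/eqP -> _].
have g_ge0 n : 0 <= g n by have := trans_ge0 n m0; rewrite -gE ler0c.
have sum_g : \sum_n g n = 1.
  have := sum_expansion kappa m0; under eq_bigr do rewrite -gE.
  by rewrite -rmorph_sum => -[].
have [P Pg] := probability_of_pmf g_ge0 sum_g.
have idm : measurable_fun [set: composition d p.+1]%classic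
    (id : composition d p.+1 -> composition d p.+1) by [].
(* [U] is the identity on the compositions themselves, so its law is [P]. *)
pose U : {RV P >-> composition d p.+1} :=
  HB.pack (id : composition d p.+1 -> composition d p.+1)
    (isMeasurableFun.Build _ _ _ _ _ idm).
exists _, _, P, U => l /andP[l_gt0 l_le_d].
rewrite (complex_expectation_law U (krawtchouk (theta R p.+1) l)).
have lawE n : (law U n)%:C%C = krawtchouk_expansion kappa n m0.
  by rewrite -gE /law Pg.
under eq_bigr do rewrite lawE.
(* The moment is [kappa l] times [Q_l] at [m0], that is [kappa l * h_l^-1], and the factor [h_l]
   restores [kappa l]. *)
rewrite expansion_moment // -mdeg_eq0 eqn0Ngt l_gt0.
by rewrite krawtchouk_concentrated mulrCA hcoef_card // mulr1.
Qed.
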